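(* For every integer $n\ge 3$, the graph $\mathcal{PD}^{TJ}(G_n)$ is disconnected, where $G_n$ is the graph defined in the context.
   Context: Graphs are finite and simple. For $n\ge 3$, the graph $G_n$ has vertex set $T_n\cup\bigcup_{i=1}^n S_{n,i}$ (disjoint union), where $T_n=\{u_1,\dots,u_{n-1}\}$ and $S_{n,i}=\{v^i_1,\dots,v^i_n\}$ for $1\le i\le n$. Its adjacencies are, for $i=1,\dots,n$ and $j=1,\dots,n-1$: $N_{G_n}(v^i_j)=\{u_j\}\cup\{v^i_p:1\le p\le n,\ p\ne j\}$, $N_{G_n}(v^i_n)=\{v^i_1,\dots,v^i_{n-1}\}$, and $N_{G_n}(u_j)=\{v^r_j:1\le r\le n\}$. For a graph $G$ and a non-empty $S\subseteq V(G)$ define $P^0[S]=S$, $P^1[S]=N[S]$ (the union of the closed neighborhoods of vertices of $S$), and for $i\ge 2$, $P^i[S]=P^{i-1}[S]\cup\{u: N_G(v)\setminus P^{i-1}[S]=\{u\}\text{ for some }v\in P^{i-1}[S]\}$. $S$ is a power dominating set if $P^t[S]=V(G)$ for some $t$; it is minimum if it has the smallest cardinality among power dominating sets. The token jumping (TJ) reconfiguration graph $\mathcal{PD}^{TJ}(G)$ has as vertices all minimum power dominating sets of $G$, with $S$ and $S'$ adjacent if and only if $S$ is obtained from $S'$ by exchanging a single vertex, i.e. $|S\setminus S'|=|S'\setminus S|=1$. *)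

(* Defs.v *)
From mathcomp Require Import all_boot.
From mathcomp Require Import boolp.

Set Implicit Arguments.
Unset Strict Implicit.
Unset Printing Implicit Defensive.

Record sgraph := SGraph {
  vertex :> finType;
  adj : rel vertex;
  adj_sym : symmetric adj;
  adj_irr : irreflexive adj }.

Arguments adj : clear implicits.

Definition nbhd (G : sgraph) (v : G) : {set G} := [set u | adj G v u].

Definition cl_nbhd (G : sgraph) (v : G) : {set G} := v |: nbhd v.

Definition disconnected (G : sgraph) : Prop :=
  exists x y : G, ~~ connect (adj G) x y.

(* P^i[S]: the step from 0 to 1 is domination, all later ones are forcing. *)
Fixpoint monitored (G : sgraph) (S : {set G}) (i : nat) : {set G} :=
  match i with
  | 0 => S
  | i'.+1 =>
      match i' with
      | 0 => \bigcup_(v in S) cl_nbhd v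
      | _ => let P := monitored S i' in
             P :|: [set u | [exists v in P, nbhd v :\: P == [set u]]]
      end
  end.

Definition power_dominating (G : sgraph) (S : {set G}) : Prop :=
  S != set0 /\ exists t, monitored S t = [set: G].

Definition minimum_power_dominating (G : sgraph) (S : {set G}) : Prop :=
  power_dominating S /\
  forall S' : {set G}, power_dominating S' -> #|S| <= #|S'|.

Definition min_pds (G : sgraph) : finType :=
  {S : {set G} | `[< minimum_power_dominating S >]}.

Definition tj_adj (G : sgraph) : rel (min_pds G) :=
  fun A B => (#|val A :\: val B| == 1) && (#|val B :\: val A| == 1).

Lemma tj_adj_sym (G : sgraph) : symmetric (@tj_adj G).
Proof. by move=> A B; rewrite /tj_adj andbC. Qed.

Lemma tj_adj_irr (G : sgraph) : irreflexive (@tj_adj G).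
Proof. by move=> A; rewrite /tj_adj setDv cards0. Qed.

Definition PD_TJ (G : sgraph) : sgraph :=
  SGraph (@tj_adj_sym G) (@tj_adj_irr G).

(* [inl j] is u_(j+1) and [inr (i, j)] is v^(i+1)_(j+1). *)
Definition Gn_vertex (n : nat) : finType := ('I_n.-1 + 'I_n * 'I_n)%type.

Definition Gn_adj (n : nat) : rel (Gn_vertex n) := fun x y =>
  match x, y with
  | inl _, inl _ => false
  | inl j, inr (_, p) => p == j :> nat
  | inr (_, p), inl j => p == j :> nat
  | inr (i, j), inr (r, p) => (r == i) && (p != j)
  end.

Lemma Gn_adj_sym (n : nat) : symmetric (@Gn_adj n).
Proof.
by move=> [j|[i j]] [k|[r p]] //=; rewrite eq_sym [p == j]eq_sym.
Qed.

Lemma Gn_adj_irr (n : nat) : irreflexive (@Gn_adj n).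
Proof. by move=> [j|[i j]] //=; rewrite !eqxx. Qed.

Definition Gn (n : nat) : sgraph := SGraph (@Gn_adj_sym n) (@Gn_adj_irr n).

(* Main.v *)
Require Import Defs.
From mathcomp Require Import all_boot.
From mathcomp Require Import boolp zify.

(** The set [T] of all the vertices u_j is an isolated vertex of the
reconfiguration graph, and it is not the only vertex.

Suppose that a set [S] misses some u_j and also misses two cliques [a] and
[b] entirely.  The vertices of these two cliques that are not adjacent to an
element of [S] then form a fort: no vertex outside has exactly one neighbour
in it.  Forcing never enters a fort, so [S] is not power dominating
([fort_not_power_dominating], [hubs_or_cliques]).  Hence a power dominating
set contains [T] or meets all the cliques but one; either way it has at least
n - 1 elements.  Both ways are attained with n - 1 elements: by [T], and by
one vertex in each of n - 1 cliques.

A minimum set other than [T] therefore meets at least n - 1 cliques, which uses up all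
its elements and makes it disjoint from [T].  As |T| = n - 1 >= 2, it takes at
least two token jumps to reach it from [T]. *)

Set Implicit Arguments.
Unset Strict Implicit.
Unset Printing Implicit Defensive.

(** * Power domination in an arbitrary graph *)

Section PowerDomination.
Variable G : sgraph.
Implicit Types (S F : {set G}) (u v w : G) (t : nat).

Lemma dominated_monitored S v u :
  v \in S -> (u == v) || adj G v u -> u \in monitored S 1.
Proof.
by move=> vS vu; apply/bigcupP; exists v; rewrite // !inE.
Qed.

Lemma monitoredW S t u : u \in monitored S t.+1 -> u \in monitored S t.+2.
Proof. by move=> uP; apply/setUP; left. Qed.

(** Unlike the definition, this asks only that the other neighbours be
monitored, so that it applies whether or not [u] already is. *)
Lemma forced_monitored S t v u :
    v \in monitored S t.+1 -> adj G v u ->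
    (forall w, adj G v w -> w != u -> w \in monitored S t.+1) ->
  u \in monitored S t.+2.
Proof.
move=> vP vu others; have [uP|uNP] := boolP (u \in monitored S t.+1).
  exact: monitoredW.
apply/setUP; right; rewrite inE; apply/existsP; exists v; rewrite vP /=.
apply/eqP/setP=> w; rewrite in_setD in_set1 inE.
have [->|wu] := eqVneq w u; first by rewrite uNP vu.
by apply/negP=> /andP[/negP wNP vw]; apply/wNP/others.
Qed.

(** A vertex that forces an element of [F] would have it as its only
unmonitored neighbour; but when the whole of [F] is unmonitored, a second
neighbour in [F] prevents this. *)
Lemma fort_not_power_dominating S F :
    F != set0 ->
    (forall v w, v \in S -> w \in F -> (w != v) && ~~ adj G v w) ->
    (forall v w, v \notin F -> w \in F -> adj G v w ->
       exists w', [/\ w' != w, w' \in F & adj G v w']) ->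
  ~ power_dominating S.
Proof.
move=> /set0Pn[w0 w0F] SF fortF [_ [t full]].
suff avoid : forall t w, w \in F -> w \notin monitored S t.
  by have := avoid t w0 w0F; rewrite full inE.
elim=> [|[|s] IH] w wF.
- by apply/negP=> wS; have := SF w w wS wF; rewrite eqxx.
- apply/bigcupP=> -[v vS]; rewrite !inE.
  by have /andP[/negPf-> /negPf->] := SF v w vS wF.
- apply/setUP=> -[|]; first by apply/negP/IH.
  rewrite inE => /existsP[v /andP[vP /eqP forces]].
  have vF : v \notin F by apply: contraL vP => /IH.
  have vw : adj G v w.
    by have : w \in [set w] := set11 w; rewrite -forces !inE => /andP[].
  have [w' [w'w w'F vw']] := fortF v w vF wF vw.
  have : w' \in [set w] by rewrite -forces in_setD inE vw' andbT; apply: IH.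
  by rewrite inE (negPf w'w).
Qed.

End PowerDomination.

Lemma isolated_disconnected (G : sgraph) (x y : G) :
  x != y -> (forall z, ~~ adj G x z) -> disconnected G.
Proof.
move=> xy isolated; exists x, y.
apply/connectP=> -[[_ /= yx|z p /= /andP[xz _]]].
  by rewrite yx eqxx in xy.
by case/negP: (isolated z).
Qed.

(** * Minimum power dominating sets of the graph *)

Section Cliques.
Variable m : nat.
Implicit Types (S : {set Gn m.+1}).

Definition hub (j : 'I_m) : Gn m.+1 := inl j.
Definition spoke (i p : 'I_m.+1) : Gn m.+1 := inr (i, p).

Definition hubs : {set Gn m.+1} := [set hub j | j : 'I_m].

Definition met_cliques S : {set 'I_m.+1} :=
  [set i | [exists p, spoke i p \in S]].

Definition clique_tips : {set Gn m.+1} :=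
  [set spoke i ord_max | i in [set~ ord_max]].

Lemma card_hubs : #|hubs| = m.
Proof. by rewrite card_imset ?card_ord // => j k []. Qed.

Lemma card_clique_tips : #|clique_tips| = m.
Proof. by rewrite card_imset ?cardsC1 ?card_ord // => i r []. Qed.

Lemma card_hubs_met_cliques S :
  #|S :&: hubs| + #|met_cliques S| <= #|S|.
Proof.
pose clique_of (x : Gn m.+1) : option 'I_m.+1 :=
  if x is inr (i, _) then Some i else None.
rewrite -(cardsID hubs S) leq_add2l.
rewrite -(card_imset (mem (met_cliques S)) Some_inj).
apply: leq_trans (leq_imset_card clique_of _); apply: subset_leq_card.
apply/subsetP=> _ /imsetP[i + ->]; rewrite inE => /existsP[p ipS].
apply/imsetP; exists (spoke i p) => //; rewrite in_setD ipS andbT.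
by apply/imsetP=> -[].
Qed.

Lemma hubs_or_cliques S :
  power_dominating S -> hubs \subset S \/ m <= #|met_cliques S|.
Proof.
move=> pdS; have [|/subsetPn[_ /imsetP[j _ ->] jS]] := boolP (hubs \subset S).
  by left.
right; rewrite leqNgt; apply/negP=> few.
have /card_gt1P[a [b [aS bS ab]]] : 1 < #|~: met_cliques S|.
  by have := cardsC (met_cliques S); rewrite card_ord; lia.
pose seen (p : 'I_m.+1) := [exists k : 'I_m, (p == k :> nat) && (hub k \in S)].
pose F : {set Gn m.+1} :=
  [set x | if x is inr (r, p) then (r \in [set a; b]) && ~~ seen p else false].
have inF r p : (spoke r p \in F) = (r \in [set a; b]) && ~~ seen p.
  by rewrite inE.
have seen_max : ~~ seen ord_max.
  by apply/existsP=> -[k /andP[/eqP /= mk _]]; have := ltn_ord k; lia.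
pose j' := widen_ord (leqnSn m) j.
have seen_j : ~~ seen j'.
  apply/existsP=> -[k /andP[/eqP /= jk]].
  by rewrite -(ord_inj jk) (negPf jS).
have unmet r p : r \in [set a; b] -> spoke r p \notin S.
  move=> rab; apply/negP=> rpS.
  have : r \in met_cliques S by rewrite inE; apply/existsP; exists p.
  apply/negP; move: rab aS bS; rewrite !in_setC => /set2P[]->//.
apply: (@fort_not_power_dominating _ S F) pdS.
- by apply/set0Pn; exists (spoke a ord_max); rewrite inF set21.
- move=> [k|[i q]] [l|[r p]]; rewrite ?[inl _ \in F]inE // inF
    => xS /andP[rab /existsP notseen].
    by apply/negP=> /= pk; apply: notseen; exists k; rewrite pk.
  have ri : r != i by apply: contraL xS => /eqP <-; exact: unmet.
  rewrite /= (negPf ri) andbT; apply/eqP=> -[ri' _].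
  by rewrite ri' eqxx in ri.
- move=> [k|[i q]] [l|[r p]]; rewrite ?[inl _ \in F]inE // !inF /=.
    (* A hub sees both cliques at the same position. *)
    move=> _ /andP[rab p_unseen] pk.
    exists (spoke (if r == a then b else a) p); rewrite inF p_unseen andbT.
    split=> //; last by case: ifP; rewrite !inE eqxx ?orbT.
    apply/eqP=> -[]; case: (eqVneq r a) => [-> /eqP|ra /esym/eqP].
      by rewrite eq_sym (negPf ab).
    by rewrite (negPf ra).
  (* The tip and the position of the missed hub [j] are both unseen, and one
     of the two differs from [p]. *)
  move=> iqF /andP[rab p_unseen] /andP[/eqP ri pq]; subst i.
  have q_seen : seen q by move: iqF; rewrite rab negbK.
  pose p' := if p == j' then ord_max else j'.
  have p'_unseen : ~~ seen p' by rewrite /p'; case: ifP.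
  exists (spoke r p'); rewrite inF rab p'_unseen /= eqxx; split=> //.
    apply/eqP=> -[]; rewrite /p'; case: (eqVneq p j') => [->|pj] /eqP.
      by rewrite -val_eqE /=; have := ltn_ord j; lia.
    by rewrite eq_sym (negPf pj).
  by apply: contraNneq p'_unseen => ->.
Qed.

Lemma power_dominating_card S : power_dominating S -> m <= #|S|.
Proof.
move=> /hubs_or_cliques[/subset_leq_card|hit]; first by rewrite card_hubs.
by have := card_hubs_met_cliques S; lia.
Qed.

Lemma hub_of_position (p : 'I_m.+1) :
  p != ord_max -> exists j : 'I_m, p = j :> nat.
Proof.
rewrite -val_eqE /= => pm.
have pltm : p < m by have := ltn_ord p; lia.
by exists (Ordinal pltm).
Qed.

(** Each clique keeps a single undominated vertex, its tip. *)
Lemma hubs_power_dominating : 0 < m -> power_dominating hubs.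
Proof.
move=> m_gt0; have inhubs j : hub j \in hubs by exact: imset_f.
split; first by apply/set0Pn; exists (hub (Ordinal m_gt0)).
have mon_hub j : hub j \in monitored hubs 1.
  by apply: (dominated_monitored (inhubs j)); rewrite eqxx.
have mon_spoke i p : p != ord_max -> spoke i p \in monitored hubs 1.
  move=> /hub_of_position[j pj].
  by apply: (dominated_monitored (inhubs j)); rewrite /= pj eqxx.
have zero_max : ord0 != ord_max :> 'I_m.+1 by rewrite -val_eqE /=; lia.
exists 2; apply/setP=> x; rewrite [RHS]inE.
case: x => [j|[i p]]; first exact/monitoredW/mon_hub.
have [->|pm] := eqVneq p ord_max; last exact/monitoredW/mon_spoke.
apply: (forced_monitored (mon_spoke i ord0 zero_max)).
  by rewrite /= eqxx eq_sym.
move=> [l|[r q]] /=; first by move=> _ _; exact: mon_hub.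
move=> /andP[/eqP-> _] qm; apply: mon_spoke.
by apply: contraNneq qm => ->.
Qed.

(** The dominated cliques force all the hubs, which force the last clique
except its tip, which comes last. *)
Lemma clique_tips_power_dominating : 0 < m -> power_dominating clique_tips.
Proof.
move=> m_gt0.
have zero_max : ord0 != ord_max :> 'I_m.+1 by rewrite -val_eqE /=; lia.
have intips i : i != ord_max -> spoke i ord_max \in clique_tips.
  by move=> im; apply: imset_f; rewrite !inE.
split; first by apply/set0Pn; exists (spoke ord0 ord_max); exact: intips.
have mon1 i p : i != ord_max -> spoke i p \in monitored clique_tips 1.
  move=> im; apply: (dominated_monitored (intips i im)) => /=.
  by have [->|_] := eqVneq p ord_max; rewrite ?eqxx ?orbT.
have mon2 j : hub j \in monitored clique_tips 2.
  apply: (forced_monitored (mon1 ord0 (widen_ord (leqnSn m) j) zero_max)).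
    by rewrite /= eqxx.
  move=> [l|[r q]] /=; last by move=> /andP[/eqP-> _] _; exact: mon1.
  by move=> /eqP jl /eqP[]; congr inl; apply/esym/ord_inj.
have mon3 i p : p != ord_max -> spoke i p \in monitored clique_tips 3.
  move=> /hub_of_position[j pj].
  have [->|im] := eqVneq i ord_max; last by do 2!apply: monitoredW; exact: mon1.
  apply: (forced_monitored (mon2 j)); first by rewrite /= pj.
  move=> [l|[r q]] //= /eqP qj rq.
  have rm : r != ord_max.
    apply: contraNneq rq => ->; apply/eqP; congr (inr (_, _)).
    by apply: ord_inj; rewrite qj pj.
  exact: monitoredW (mon1 r q rm).
exists 4; apply/setP=> x; rewrite [RHS]inE.
case: x => [j|[i p]]; first by do 2!apply: monitoredW; exact: mon2.
have [->|pm] := eqVneq p ord_max; last exact/monitoredW/mon3.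
apply: (forced_monitored (mon3 i ord0 zero_max)).
  by rewrite /= eqxx eq_sym.
move=> [l|[r q]] /=; first by move=> _ _; exact: monitoredW (mon2 l).
move=> /andP[/eqP-> _] qm; apply: mon3.
by apply: contraNneq qm => ->.
Qed.

Lemma minimum_power_dominating_card S :
  power_dominating S -> #|S| = m -> minimum_power_dominating S.
Proof.
by move=> pdS cardS; split=> // S'; rewrite cardS; apply: power_dominating_card.
Qed.

(** A set with [m] elements that meets at least [m] cliques has no room for a
hub. *)
Lemma hubs_subset_or_disjoint S :
  0 < m -> minimum_power_dominating S -> hubs \subset S \/ S :&: hubs = set0.
Proof.
move=> m_gt0 [/hubs_or_cliques[|hit] minS]; first by left.
right; apply/eqP; rewrite -cards_eq0.
have := minS _ (hubs_power_dominating m_gt0); rewrite card_hubs.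
by have := card_hubs_met_cliques S; lia.
Qed.

End Cliques.

Theorem corollary5p11 (n : nat) (hn : 3 <= n) : disconnected (PD_TJ (Gn n)).
Proof.
case: n hn => [//|m] hm; have m_gt0 : 0 < m by lia.
have minT : minimum_power_dominating (hubs m).
  apply: minimum_power_dominating_card (card_hubs m).
  exact: hubs_power_dominating.
have minR : minimum_power_dominating (clique_tips m).
  apply: minimum_power_dominating_card (card_clique_tips m).
  exact: clique_tips_power_dominating.
pose T : PD_TJ (Gn m.+1) := Sub (hubs m) (asboolT minT).
pose R : PD_TJ (Gn m.+1) := Sub (clique_tips m) (asboolT minR).
apply: (@isolated_disconnected _ T R).
  apply/eqP=> /(congr1 val) /= TR.
  have : hub (Ordinal m_gt0) \in hubs m by exact: imset_f.
  by rewrite TR => /imsetP[].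
move=> B; apply/negP=> /andP[/= one _]; move: one.
have [TB|BT] := hubs_subset_or_disjoint m_gt0 (asboolW (valP B)).
  by move: TB; rewrite -setD_eq0 => /eqP->; rewrite cards0.
by rewrite -[_ :\: _]setU0 -(setDv (hubs m)) -setDIr BT setD0 card_hubs; lia.
Qed.
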